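(* Let $d\ge1$ and $0<r<1$. Then almost surely there exists $N>0$ such that for all $n\ge N$, $$\lambda^{(n)}_2>\tfrac12.$$
   Context: Let $X_1,X_2,\ldots$ be i.i.d. uniformly distributed random points in $[-1,1]^d$, and let $\|x\|=\max_{1\le k\le d}|x_k|$ for $x\in\mathbb{R}^d$. For $r>0$ let $h_r(x,y)=1$ if $\|x-y\|\le r$ and $h_r(x,y)=0$ otherwise. Let $A_{n,r}$ be the $n\times n$ matrix with entries $(A_{n,r})_{i,j}=h_r(X_i,X_j)$ (including $i=j$), let $D_{n,r}=\mathrm{diag}(d_1,\ldots,d_n)$ with $d_i=\sum_{j=1}^n (A_{n,r})_{i,j}$, and let $W_{n,r}=D_{n,r}^{-1/2}A_{n,r}D_{n,r}^{-1/2}$. Let $\lambda^{(n)}_1\ge\lambda^{(n)}_2\ge\cdots\ge\lambda^{(n)}_n$ be the eigenvalues of $W_{n,r}$ counted with multiplicity. *)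

(* Defs.v *)
From HB Require Import structures.
From mathcomp Require Import all_boot all_order all_algebra.
From mathcomp Require Import all_classical all_reals all_analysis.

Set Implicit Arguments.
Unset Strict Implicit.
Unset Printing Implicit Defensive.

Import Order.TTheory GRing.Theory Num.Theory.
Import numFieldNormedType.Exports.

Local Open Scope classical_set_scope.
Local Open Scope ring_scope.

(* Points of R^d are d-tuples, which carry the product sigma-algebra. *)

Section Space.
Variables (R : realType) (d : nat).

Definition supdist (x y : d.-tuple R) : R :=
  \big[Num.max/0]_(k < d) `|tnth x k - tnth y k|.

Definition cube : set (d.-tuple R) :=
  [set x | forall k : 'I_d, -1 <= tnth x k <= 1].

End Space.

(* Lebesgue measure on R^d: the iterated integral is what the library's product
   measure [lebesgue_measure \x lebesgue_tuple d] unfolds to, transported along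
   R * R^d = R^(d+1). *)
Fixpoint lebesgue_tuple (R : realType) (d : nat) :
    set (d.-tuple R) -> \bar R :=
  match d with
  | 0 => fun B => \d_[tuple] B
  | d'.+1 => fun B =>
      (\int[lebesgue_measure]_x
         lebesgue_tuple [set y : d'.-tuple R | B [tuple of x :: y]])%E
  end.

Section Sample.
Context {disp : measure_display} {T : measurableType disp} {R : realType}.
Variables (P : probability T R) (d : nat).
Implicit Type X : nat -> {RV P >-> d.-tuple R}.

Definition mutually_independent X : Prop :=
  forall (s : seq nat) (B : nat -> set (d.-tuple R)),
    uniq s -> (forall i, measurable (B i)) ->
    P (\bigcap_(i in [set` s]) (X i @^-1` B i)) =
    (\prod_(i <- s) P (X i @^-1` B i))%E.

Definition uniform_on_cube (Y : {RV P >-> d.-tuple R}) : Prop :=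
  forall B : set (d.-tuple R), measurable B ->
    distribution P Y B =
    (lebesgue_tuple (B `&` @cube R d) / lebesgue_tuple (@cube R d))%E.

Definition iid_uniform_on_cube X : Prop :=
  mutually_independent X /\ forall i, uniform_on_cube (X i).

End Sample.

Section Graph.
Variables (R : realType) (d n : nat) (r : R) (x : 'I_n -> d.-tuple R).

Definition adjmx : 'M[R]_n := \matrix_(i, j) (supdist (x i) (x j) <= r)%R%:R.

Definition degree (i : 'I_n) : R := \sum_(j < n) adjmx i j.

(* Every degree is at least 1 when 0 <= r, because of the diagonal of adjmx,
   so that the inverse square roots are genuine. *)
Definition deg_invsqrt : 'M[R]_n := diag_mx (\row_i (Num.sqrt (degree i))^-1).

Definition normalized_adjmx : 'M[R]_n := deg_invsqrt *m adjmx *m deg_invsqrt.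

End Graph.

Definition is_spectrum (R : realType) n (A : 'M[R]_n) (s : seq R) : Prop :=
  sorted >=%R s /\ char_poly A = \prod_(a <- s) ('X - a%:P).

(* The eigenvalues with multiplicity in nonincreasing order; such a list is
   unique, and it exists for a symmetric real matrix. The value is the empty
   list when the characteristic polynomial does not split. *)
Definition spectrum (R : realType) n (A : 'M[R]_n) : seq R :=
  xget [::] [set s | is_spectrum A s].

(* Numbered from 1: [lambda 1 A] is the largest eigenvalue. *)
Definition lambda (R : realType) n (k : nat) (A : 'M[R]_n) : R :=
  nth 0 (spectrum A) k.-1.

(* Main.v *)
Require Import Defs.
From mathcomp Require Import all_boot all_order all_algebra.
From mathcomp Require Import all_classical all_reals all_analysis.
From mathcomp Require Import measurable_realfun.
From mathcomp Require Import spectral sesquilinear complex.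
From mathcomp Require Import ring lra zify.

(* In the continuum limit one step of the walk sends a point to a uniform point
   of its neighbourhood, so the first coordinate [x] is sent on average to the
   midpoint [M x] of [x - r, x + r] cut by [-1, 1]. For [r < 1] one has
   [x * (2 * M x - x) >= (1 - r) * x ^ 2], hence [W - 1/2] is positive definite
   on the plane spanned by [D^(1/2) 1] and [D^(1/2) x], and at least two
   eigenvalues exceed 1/2.

   For the sample, cut [-1, 1)^d into m^d cells, replace the first coordinate
   by that of the centre of the cell, and squeeze the adjacency relation between
   two relations on cells. Averages over pairs of sample points then converge to
   averages over pairs of cells, because the finitely many cell frequencies
   converge almost surely. The lower and the upper relation differ on a
   proportion [4 * d / m] of the pairs at most, which is negligible for large m. *)

Set Implicit Arguments.
Unset Strict Implicit.
Unset Printing Implicit Defensive.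

Import Order.TTheory GRing.Theory Num.Theory.
Import numFieldNormedType.Exports.
Local Open Scope classical_set_scope.
Local Open Scope ring_scope.

(** * Two eigenvalues from a positive definite plane *)

Lemma char_poly_conj (F : fieldType) n (P A : 'M[F]_n) : P \in unitmx ->
  char_poly (invmx P *m A *m P) = char_poly A.
Proof.
move=> Pu; rewrite /char_poly.
have -> : char_poly_mx (invmx P *m A *m P) =
    map_mx polyC (invmx P) *m char_poly_mx A *m map_mx polyC P.
  rewrite /char_poly_mx mulmxBr mulmxBl -!map_mxM/=; congr (_ - _).
  by rewrite scalar_mxC -mulmxA -map_mxM/= mulVmx// map_mx1 mulmx1.
by rewrite !det_mulmx mulrAC -det_mulmx -map_mxM/= mulVmx// map_mx1 det1 mul1r.
Qed.

Section HermitianForms.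
Local Open Scope sesquilinear_scope.

(** The unitary diagonalization of [A] makes the form diagonal in the coordinates of [z] along the
    eigenvectors. *)
Lemma hermitian_form_spectral (C : numClosedFieldType) n (A : 'M[C]_n)
    (z : 'rV[C]_n) : A \is hermsymmx ->
  (z *m A *m z ^t*) 0 0 =
  \sum_i spectral_diag A 0 i * `|(z *m (spectralmx A) ^t*) 0 i| ^+ 2.
Proof.
move=> /hermitian_normalmx /orthomx_spectralP A_eq.
rewrite {1}A_eq invmx_unitary ?spectral_unitarymx// !mulmxA.
set w := z *m _.
have -> : w *m diag_mx (spectral_diag A) *m spectralmx A *m z^t* =
   w *m diag_mx (spectral_diag A) *m w^t*.
  by rewrite {2}/w trmx_mul map_mxM/= trmxCK !mulmxA.
rewrite mxE; apply: eq_bigr => i _; rewrite mul_mx_diag !mxE normCK.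
ring.
Qed.

Lemma sqr_form_spectral (C : numClosedFieldType) n (A : 'M[C]_n)
    (z : 'rV[C]_n) :
  (z *m z ^t*) 0 0 = \sum_i `|(z *m (spectralmx A) ^t*) 0 i| ^+ 2.
Proof.
have PU : (spectralmx A)^t* *m spectralmx A = 1%:M.
  have /unitarymxP := spectral_unitarymx A.
  by move=> /mulmx1C.
have -> : z *m z^t* = (z *m (spectralmx A) ^t*) *m (z *m (spectralmx A) ^t*)^t*.
  by rewrite trmx_mul map_mxM/= trmxCK mulmxA -(mulmxA z) PU mulmx1.
by rewrite mxE; apply: eq_bigr => i _; rewrite normCK !mxE.
Qed.

Lemma sesqui_form_comb (C : numClosedFieldType) n (M : 'M[C]_n)
    (u v : 'rV[C]_n) (a b : C) :
  ((a *: u + b *: v) *m M *m (a *: u + b *: v)^t*) 0 0 =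
  a * a^* * (u *m M *m u^t*) 0 0 +
  (a * b^* * (u *m M *m v^t*) 0 0 + b * a^* * (v *m M *m u^t*) 0 0) +
  b * b^* * (v *m M *m v^t*) 0 0.
Proof.
have mxS (c : C) (B : 'M[C]_(1, 1)) : (c *: B) 0 0 = c * B 0 0 by rewrite mxE.
have mxA (B D : 'M[C]_(1, 1)) : (B + D) 0 0 = B 0 0 + D 0 0 by rewrite mxE.
rewrite linearD/= !linearZ/= map_mxD !map_mxZ !mulmxDl !mulmxDr.
by rewrite -!scalemxAl -!scalemxAr !(mxS, mxA); ring.
Qed.

(** Completing the square in the Hermitian form of the real matrix with rows (x, y) and (y, z):
    positivity of [x] and of the determinant makes it positive definite. *)
Lemma complete_sqr_normC (C : numClosedFieldType) (a b x y z : C) :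
  x \is Num.real -> y \is Num.real ->
  x * (a * a^* * x + (a * b^* + b * a^*) * y + b * b^* * z) =
  `|a * x + b * y| ^+ 2 + `|b| ^+ 2 * (x * z - y ^+ 2).
Proof.
move=> /conj_Creal xR /conj_Creal yR.
rewrite !normCK rmorphD !rmorphM/= xR yR.
ring.
Qed.

End HermitianForms.

(** If the second entry were at most [t], so would be all later ones, and only the head could be
    counted. *)
Lemma count_gt_sorted (R : realType) (s : seq R) (t : R) :
  sorted >=%R s -> (2 <= count (fun x => (t < x)%R) s)%N -> t < nth 0 s 1.
Proof.
case: s => [|x [|y s]]//=; first by case: (t < x).
move=> /andP[xy pys] ; apply: contraLR; rewrite -leNgt -ltnNge => yt.
have -> : count (fun x => t < x) s = 0%N.
  apply/eqP; rewrite -leqn0 leqNgt -has_count; apply/hasPn => z zs.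
  rewrite -leNgt (le_trans _ yt)//.
  have /allP/(_ z zs)// : all (>=%R y) s.
  by apply: order_path_min pys => a b c /= ba ac; apply: le_trans ac ba.
by rewrite (ltNge t y) yt/=; case: (t < x).
Qed.

(** Sorting the [e i] gives the [xget] in [spectrum] a witness, and a product of monic linear
    factors determines its roots as a multiset. *)
Lemma spectrum_perm_eq (R : realType) n (A : 'M[R]_n) (e : 'I_n -> R) :
  char_poly A = \prod_(i < n) ('X - (e i)%:P) ->
  sorted >=%R (spectrum A) /\ perm_eq (spectrum A) [seq e i | i <- enum 'I_n].
Proof.
move=> Ae.
have [] : is_spectrum A (spectrum A).
  apply: xgetPex; exists (sort >=%R [seq e i | i <- enum 'I_n]); split.
    by apply: sort_sorted => x y /=; exact: le_total.
  by rewrite Ae (perm_big _ (permEl (perm_sort _ _))) big_map big_enum.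
move=> ss cs; split=> //; apply: prod_XsubC_eq.
by rewrite -cs Ae big_map big_enum.
Qed.

Section SecondEigenvalue.
Local Open Scope sesquilinear_scope.
Local Open Scope complex_scope.

(* If at most one eigenvalue exceeded [t], some nonzero complex combination of
   [u] and [v] would be orthogonal to its eigenvector. *)
Lemma lambda2_gt (R : realType) n (A : 'M[R]_n) (t : R) (u v : 'rV[R]_n)
    (q := fun x y : 'rV[R]_n => (x *m (A - t%:M) *m y^T) 0 0) :
  A^T = A -> 0 < q u u -> q u v ^+ 2 < q u u * q v v -> t < lambda 2 A.
Proof.
move=> Asym quu quv.
pose f := real_complex R; pose AC := map_mx f A.
have fR x : f x \is Num.real by rewrite complex_real.
have AH : AC \is hermsymmx.
  apply: realsym_hermsym.
    apply/is_hermitianmxP; rewrite expr0 scale1r map_mx_id//.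
    by rewrite /AC map_trmx Asym.
  by apply/mxOverP => i j; rewrite mxE fR.
pose e i := complex.Re (spectral_diag AC 0 i).
have eE i : f (e i) = spectral_diag AC 0 i.
  by rewrite /f /e RRe_real//; have /mxOverP := hermitian_spectral_diag_real AH; apply.
have [ss sp] : sorted >=%R (spectrum A) /\
    perm_eq (spectrum A) [seq e i | i <- enum 'I_n].
  apply: spectrum_perm_eq; apply: (map_poly_inj f).
  rewrite map_char_poly -/AC map_prod_XsubC.
  have /hermitian_normalmx /orthomx_spectralP A_eq := AH.
  rewrite [in LHS]A_eq char_poly_conj ?spectral_unit//.
  rewrite char_poly_trig ?diag_mx_is_trig//.
  by apply: eq_bigr => i _; rewrite mxE eqxx mulr1n -eE.
apply: count_gt_sorted => //.
rewrite (permP sp) count_map.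
have -> : count (preim e (fun x => t < x)) (enum 'I_n) = #|[pred i | t < e i]|.
  by rewrite cardE [in RHS]/enum_mem size_filter enumT.
rewrite ltnNge; apply/negP => card1.
have [i0 i0P] : exists i0 : 'I_n, forall i, t < e i -> i = i0.
  case: (pickP [pred i | t < e i]) => [i0 /= i0P|no].
    by exists i0 => i ti; have /card_le1_eqP := card1; apply; rewrite inE.
  (* With no eigenvalue above [t] any index serves as [i0]; positivity of [q u u] ensures that there
     is one. *)
  have n0 : (0 < n)%N.
    rewrite lt0n; apply/eqP => n0; move: quu.
    rewrite /q mxE big1 ?ltxx// => i _.
    by exfalso; have := ltn_ord i; rewrite [X in (_ < X)%N]n0.
  by exists (Ordinal n0) => i ti; have := no i; rewrite /= ti.
pose P := spectralmx AC.
pose u' := map_mx f u; pose v' := map_mx f v.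
pose M := map_mx f (A - t%:M).
have ME : M = AC - (f t)%:M by rewrite /M map_mxB map_scalar_mx.
have qE (x y : 'rV[R]_n) : (map_mx f x *m M *m (map_mx f y)^T) 0 0 = f (q x y).
  by rewrite /q map_trmx -!map_mxM mxE.
have conjf (x : 'rV[R]_n) : (map_mx f x)^t* = (map_mx f x)^T.
  by apply/matrixP => i j; rewrite !mxE conj_Creal.
have qC : q v u = q u v.
  rewrite /q; transitivity (((v *m (A - t%:M) *m u^T)^T) 0 0); first by rewrite [RHS]mxE.
  by rewrite !trmx_mul trmxK linearB/= tr_scalar_mx Asym mulmxA.
have [a [b [ab0 Eab]]] : exists a b : R[i], (a != 0) || (b != 0) /\
    ((a *: u' + b *: v') *m P^t*) 0 i0 = 0.
  have E a b : ((a *: u' + b *: v') *m P^t*) 0 i0 =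
      a * (u' *m P^t*) 0 i0 + b * (v' *m P^t*) 0 i0.
    by rewrite mulmxDl -!scalemxAl !mxE.
  have [u0|u0] := eqVneq ((u' *m P^t*) 0 i0) 0.
    by exists 1, 0; rewrite oner_eq0 E u0 mulr0 mul0r addr0.
  exists ((v' *m P^t*) 0 i0), (- (u' *m P^t*) 0 i0).
  by rewrite E oppr_eq0 u0 orbT; split=> //; ring.
pose z := a *: u' + b *: v'.
have mxS (c : R[i]) (B : 'M[complex R]_(1, 1)) : (c *: B) 0 0 = c * B 0 0 by rewrite mxE.
have mxA (B C : 'M[complex R]_(1, 1)) : (B + C) 0 0 = B 0 0 + C 0 0 by rewrite mxE.
(* In the eigenbasis the coefficient of [z] at [i0] vanishes, and every other index has eigenvalue
   at most [t]. *)
have le0 : (z *m M *m z^t*) 0 0 <= 0.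
  have -> : (z *m M *m z^t*) 0 0 =
      (z *m AC *m z^t*) 0 0 - f t * (z *m z^t*) 0 0.
    by rewrite ME mulmxBr mulmxBl mul_mx_scalar -scalemxAl -scaleN1r mxA !mxS mulN1r.
  rewrite hermitian_form_spectral// (sqr_form_spectral AC) mulr_sumr -sumrB.
  apply: sumr_le0 => i _; rewrite -mulrBl -eE -rmorphB.
  have [ti|ti] := ltP t (e i); last first.
    by rewrite mulr_le0_ge0 ?exprn_ge0// lecR subr_le0.
  by rewrite (i0P i ti) Eab normr0 expr0n mulr0.
(* Contradiction: completing the square makes the form positive at every combination with nonzero
   coefficients (a, b). *)
suff: 0 < f (q u u) * (z *m M *m z^t*) 0 0.
  have fquu : 0 < f (q u u) by rewrite ltcR.
  by rewrite pmulr_rgt0// => /lt_geF; rewrite le0.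
have E := sesqui_form_comb M u' v' a b.
rewrite !conjf !qE qC in E.
rewrite /z E -mulrDl complete_sqr_normC//.
have fdet : 0 < f (q u u) * f (q v v) - f (q u v) ^+ 2.
  by rewrite -rmorphM -rmorphXn -rmorphB ltcR subr_gt0.
have [b0|b0] := eqVneq b 0.
  rewrite b0 normr0 expr0n !mul0r !addr0 exprn_gt0// normr_gt0 mulf_neq0//.
    by move: ab0; rewrite b0 eqxx orbF.
  by rewrite gt_eqF// ltcR.
by rewrite ltr_wpDl ?exprn_ge0// mulr_gt0 ?exprn_gt0 ?normr_gt0.
Qed.

End SecondEigenvalue.

(** * The quadratic form of the normalized adjacency matrix *)

Lemma supdistC (R : realType) d (x y : d.-tuple R) : supdist x y = supdist y x.
Proof. by apply: eq_bigr => k _; rewrite distrC. Qed.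

Section NormalizedAdjacency.
Variables (R : realType) (d n : nat) (r : R) (x : 'I_n -> d.-tuple R).
Hypothesis r0 : 0 <= r.
Let A := adjmx r x.
Let W := normalized_adjmx r x.

Let AC i j : A i j = A j i.
Proof. by rewrite !mxE supdistC. Qed.

Let dgt0 i : 0 < degree r x i.
Proof.
rewrite /degree (bigD1 i)//= ltr_pwDl//; last first.
  by apply: sumr_ge0 => j _; rewrite mxE.
rewrite mxE /supdist (_ : (_ <= r) = true) ?ltr01//.
by rewrite big1_idem//= ?maxxx// => k _; rewrite subrr normr0.
Qed.

Lemma normalized_adjmxE i j :
  W i j = A i j / (Num.sqrt (degree r x i) * Num.sqrt (degree r x j)).
Proof.
rewrite /W /normalized_adjmx /deg_invsqrt mul_mx_diag mul_diag_mx.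
by rewrite !mxE invfM mulrCA mulrA.
Qed.

Lemma normalized_adjmx_sym : W^T = W.
Proof. by apply/matrixP => i j; rewrite mxE !normalized_adjmxE AC [X in _ / X]mulrC. Qed.

Let rv (g : 'I_n -> R) := \row_i (Num.sqrt (degree r x i) * g i).

(** The square roots of the degrees cancel the normalization of [W]; the degree left by the scalar
    matrix is expanded as a row sum of [A]. *)
Lemma normalized_adjmx_form (g h : 'I_n -> R) :
  (rv g *m (W - (2^-1)%:M) *m (rv h)^T) 0 0 =
  \sum_i \sum_j A i j * (g i * h j - 2^-1 * (g i * h i)).
Proof.
have sn0 i : Num.sqrt (degree r x i) != 0 by rewrite gt_eqF// sqrtr_gt0.
rewrite mulmxBr mulmxBl mul_mx_scalar -scalemxAl.
rewrite [LHS]mxE [X in _ + X]mxE [X in _ - X]mxE.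
rewrite -mulmxA mxE [X in _ * X]mxE mulr_sumr -sumrB; apply: eq_bigr => i _.
under eq_bigr do rewrite mulrBr.
rewrite sumrB -mulr_suml -/(degree r x i) !mxE mulr_sumr; congr (_ - _).
  by apply: eq_bigr => j _; rewrite normalized_adjmxE !mxE; field; rewrite !sn0.
by rewrite -[in RHS](sqr_sqrtr (ltW (dgt0 i))); ring.
Qed.

(* The test vectors are [D^(1/2) 1] and [D^(1/2) f]. *)
Lemma lambda2_normalized_adjmx_gt (f : 'I_n -> R) :
  0 < \sum_i \sum_j A i j ->
  (\sum_i \sum_j A i j * f i) ^+ 2 <
    (\sum_i \sum_j A i j) * \sum_i \sum_j A i j * (2 * f i * f j - f i ^+ 2) ->
  2^-1 < lambda 2 W.
Proof.
move=> A0 Af.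
pose one := fun _ : 'I_n => 1 : R.
have E11 : (rv one *m (W - (2^-1)%:M) *m (rv one)^T) 0 0 =
    2^-1 * \sum_i \sum_j A i j.
  rewrite normalized_adjmx_form mulr_sumr; apply: eq_bigr => i _.
  by rewrite mulr_sumr; apply: eq_bigr => j _; rewrite /one; field.
have E1f : (rv one *m (W - (2^-1)%:M) *m (rv f)^T) 0 0 =
    2^-1 * \sum_i \sum_j A i j * f i.
  rewrite normalized_adjmx_form.
  under eq_bigr do (under eq_bigr do rewrite !mul1r mulrBr; rewrite sumrB).
  (* By symmetry of [A], the weights [f j] and [f i] give the same double sum. *)
  rewrite sumrB exchange_big/=.
  under eq_bigr do under eq_bigr do rewrite AC.
  rewrite mulr_sumr -sumrB; apply: eq_bigr => i _.
  by rewrite mulr_sumr -sumrB; apply: eq_bigr => j _; field.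
have Eff : (rv f *m (W - (2^-1)%:M) *m (rv f)^T) 0 0 =
    2^-1 * \sum_i \sum_j A i j * (2 * f i * f j - f i ^+ 2).
  rewrite normalized_adjmx_form mulr_sumr; apply: eq_bigr => i _.
  by rewrite mulr_sumr; apply: eq_bigr => j _; field.
apply: (lambda2_gt (u := rv one) (v := rv f)); first exact: normalized_adjmx_sym.
  by rewrite E11 mulr_gt0.
by rewrite E11 E1f Eff exprMn [ltRHS]mulrACA -(expr2 2^-1) ltr_pM2l//.
Qed.

End NormalizedAdjacency.

(** * A law of large numbers *)

Lemma exists_sqr_bounds (n : nat) : exists k, (k ^ 2 <= n < k.+1 ^ 2)%N.
Proof.
elim: n => [|n [k /andP[kn nk]]]; first by exists 0%N.
have [h|h] := ltnP n.+1 (k.+1 ^ 2); [exists k|exists k.+1]; lia.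
Qed.

(** For k^2 <= n < (k + 1)^2 the value at [n] differs from that at k^2 by at most 2 k, which is
    negligible against n >= k^2. *)
Lemma cvg_average_squares (R : realType) (s : nat -> R) :
  (forall m n, (m <= n)%N -> `|s n - s m| <= (n - m)%:R) ->
  (fun k => s (k.+1 ^ 2)%N / (k.+1 ^ 2)%:R) @ \oo --> (0 : R) ->
  (fun n => s n / n%:R) @ \oo --> (0 : R).
Proof.
move=> s_lip /cvgrPdist_le s_sq; apply/cvgrPdist_le => e e0.
have [K _ KP] := s_sq _ (divr_gt0 e0 (ltr0n R 2)).
(* For k > L one gets 2 k <= (e / 2) k^2, so the gap uses up only half of [e]. *)
have [L Le] : exists L : nat, 4 / e < L%:R.
  by exists (Num.bound (4 / e)); apply: archi_boundP; rewrite divr_ge0// ltW.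
near=> n.
have [k /andP[kn nk]] := exists_sqr_bounds n.
have hk : (maxn K L < k)%N.
  rewrite ltnNge; apply/negP => kKL.
  have : (n < (maxn K L).+1 ^ 2)%N by rewrite (leq_trans nk)// leq_exp2r.
  by apply/negP; rewrite -leqNgt; near: n; exists ((maxn K L).+1 ^ 2)%N.
have [Kk Lk] : (K < k)%N /\ (L < k)%N by move: hk; rewrite gtn_max => /andP[].
have k0 : (0 < k)%N by exact: leq_ltn_trans Kk.
have k0R : 0 < k%:R :> R by rewrite ltr0n.
have n0R : 0 < n%:R :> R by rewrite ltr0n (leq_trans _ kn)// expn_gt0 k0.
(* The subsequence is indexed by [k.+1], so k^2 is reached at [k.-1]. *)
have := KP k.-1; rewrite /= prednK// sub0r normrN normrM normfV (ger0_norm (ler0n _ _)).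
rewrite ler_pdivrMr ?ltr0n ?expn_gt0 ?k0// => /(_ _) skP.
rewrite sub0r normrN normrM normfV (ger0_norm (ltW n0R)) ler_pdivrMr//.
have skk : `|s (k ^ 2)%N| <= e / 2 * (k ^ 2)%:R by apply: skP; rewrite /= -ltnS prednK.
have sd := s_lip _ _ kn.
have sn : `|s n| <= `|s (k ^ 2)%N| + `|s n - s (k ^ 2)%N|.
  by rewrite -{1}(subrKC (s (k ^ 2)%N) (s n)) ler_normD.
have nR : (n - k ^ 2)%:R <= 2 * k%:R :> R.
  rewrite -natrM ler_nat; lia.
have kn2 : k%:R ^+ 2 <= n%:R :> R by rewrite -natrX ler_nat.
have ek : 4 <= e * k%:R.
  rewrite mulrC -ler_pdivrMr// ltW// (lt_le_trans Le)// ler_nat ltnW//.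
rewrite natrX in skk.
nra.
Unshelve. all: by end_near. Qed.

Lemma cvg_sum_sqr_0 (R : realType) (u : nat -> R) :
  (\sum_(k <oo) (u k ^+ 2)%:E < +oo)%E -> u @ \oo --> 0.
Proof.
move=> uoo.
have u0 k : (0 <= (u k ^+ 2)%:E)%E by rewrite lee_fin sqr_ge0.
have ufin : (\sum_(k <oo) (u k ^+ 2)%:E)%E \is a fin_num.
  by rewrite ge0_fin_numE// nneseries_ge0.
have : (fun k => u k ^+ 2) @ \oo --> 0.
  apply: cvg_series_cvg_0; apply: nondecreasing_is_cvgn.
    by apply: nondecreasing_series => k _ _; rewrite sqr_ge0.
  exists (fine (\sum_(k <oo) (u k ^+ 2)%:E)%E) => _ [n _ <-].
  rewrite -lee_fin fineK// /series/= -sumEFin.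
  exact: nneseries_lim_ge.
move=> /cvgrPdist_lt u2; apply/cvgrPdist_lt => e e0.
have [N _ NP] := u2 _ (exprn_gt0 2 e0).
exists N => // n Nn; have := NP n Nn; rewrite /= !sub0r !normrN.
by rewrite ger0_norm ?sqr_ge0// -[X in X < _]real_normK ?num_real// ltr_pXn2r// nnegrE// ltW.
Qed.

(** The terms 1/x^2 with x = k + 1 are dominated by the telescoping differences 2/x - 2/(x + 1). *)
Lemma nneseries_inv_sqr_le2 (R : realType) :
  (\sum_(k <oo) (((k.+1 ^ 2)%:R)^-1 : R)%:E <= 2%:E)%E.
Proof.
apply: lime_le.
  by apply: is_cvg_nneseries => k _ _; rewrite lee_fin invr_ge0.
apply: nearW => n; rewrite sumEFin lee_fin.
apply: (@le_trans _ _ (2 - 2 / n.+1%:R)); last by rewrite gerBl.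
elim: n => [|n IH]; first by rewrite big_nil divr1 subrr.
rewrite big_nat_recr//= (le_trans (lerD IH (lexx _)))//.
rewrite natrX -[n.+2%:R]natr1 -subr_ge0.
have n0 : 1 <= n.+1%:R :> R by rewrite ler1n.
set x := n.+1%:R in n0 *.
have -> : 2 - 2 / (x + 1) - (2 - 2 / x + (x ^+ 2)^-1) = (x - 1) / (x ^+ 2 * (x + 1)).
  by field; apply/andP; split; apply: lt0r_neq0; lra.
by rewrite divr_ge0 ?subr_ge0// mulr_ge0 ?sqr_ge0//; lra.
Qed.

Section PairwiseIndependentEvents.
Context d (T : measurableType d) (R : realType) (P : probability T R).
Variables (E : nat -> set T) (p : R).
Hypothesis mE : forall i, measurable (E i).
Hypothesis PE : forall i, P (E i) = p%:E.
Hypothesis PEE : forall i j, i != j -> P (E i `&` E j) = (p ^+ 2)%:E.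

Let S n (w : T) : R := \sum_(i < n) \1_(E i) w.

Let p0 : 0 <= p.
Proof. by rewrite -lee_fin -(PE 0) measure_ge0. Qed.

Let mS n : measurable_fun setT (S n).
Proof. by apply: measurable_sum => i; exact: measurable_indic. Qed.

Let S_ge0 n w : 0 <= S n w.
Proof. by apply: sumr_ge0 => i _. Qed.

Let int1 A : measurable A -> (\int[P]_w (\1_A w)%:E)%E = P A.
Proof. by move=> mA; rewrite integral_indic// setIT. Qed.

Let intS n : (\int[P]_w (S n w)%:E)%E = (n%:R * p)%:E.
Proof.
under eq_integral do rewrite -sumEFin.
rewrite ge0_integral_sum//=; last first.
  by move=> i; apply/measurable_EFinP; exact: measurable_indic.
under eq_bigr do rewrite int1// PE.
by rewrite sumEFin sumr_const card_ord mulr_natl.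
Qed.

(** The expanded square has [n] diagonal pairs of probability [p] and [n * n - n] pairs of distinct
    indices, of probability p^2 each. *)
Let intSS n : (\int[P]_w (S n w ^+ 2)%:E)%E =
  (n%:R * p + (n * n - n)%:R * p ^+ 2)%:E.
Proof.
have -> : (\int[P]_w (S n w ^+ 2)%:E)%E =
   (\int[P]_w (\sum_(i < n) \sum_(j < n) (\1_(E i `&` E j) w)%:E))%E.
  apply: eq_integral => w _; rewrite expr2 /S mulr_suml -sumEFin.
  apply: eq_bigr => i _; rewrite mulr_sumr -sumEFin.
  by apply: eq_bigr => j _; rewrite indicI.
rewrite ge0_integral_sum//=; last 2 first.
  move=> i; apply: emeasurable_sum => j.
  by apply/measurable_EFinP; apply: measurable_indic; exact: measurableI.
  by move=> i w _; apply: sume_ge0 => j _; rewrite lee_fin.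
under eq_bigr => i _.
  rewrite ge0_integral_sum//=; last first.
    move=> j; apply/measurable_EFinP; apply: measurable_indic.
    exact: measurableI.
  rewrite (bigD1 i)//= setIid int1// PE.
  under eq_bigr => j ji.
    rewrite int1; last exact: measurableI.
    rewrite PEE; last by rewrite eq_sym.
    over.
  rewrite sumEFin sumr_const (cardC1 i) card_ord -mulr_natl -EFinD.
  over.
rewrite sumEFin sumr_const card_ord -[X in X%:E = _]mulr_natl mulrDr mulrA -natrM.
by congr (_ + _%:R * _)%:E; case: n => // n; lia.
Qed.

Let variance_le n :
  (\int[P]_w ((S n w - n%:R * p) ^+ 2)%:E <= n%:R%:E)%E.
Proof.
have p1 : p <= 1 by rewrite -lee_fin -(PE 0) probability_le1.
(* The cross term stands on the left so that all integrands are nonnegative and the integrals split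
   without an integrability argument. The variance comes out as n p (1 - p). *)
have : (\int[P]_w (((S n w - n%:R * p) ^+ 2)%:E + (2 * n%:R * p)%:E * (S n w)%:E) =
        \int[P]_w ((S n w ^+ 2)%:E + ((n%:R * p) ^+ 2)%:E))%E.
  by apply: eq_integral => w _; rewrite -EFinM -!EFinD; congr (_%:E); ring.
have np0 : 0 <= 2 * n%:R * p by rewrite !mulr_ge0.
have mSm : measurable_fun setT (fun w => ((S n w - n%:R * p) ^+ 2)%:E).
  by apply/measurable_EFinP; apply: measurable_funX; exact: measurable_funB.
have mSS : measurable_fun setT (fun w => (S n w ^+ 2)%:E).
  by apply/measurable_EFinP; exact: measurable_funX.
have mSE : measurable_fun setT (EFin \o S n) by exact/measurable_EFinP.
rewrite !(ge0_integralD, ge0_integralZl_EFin)//=;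
  try by [move=> w; rewrite ?lee_fin ?sqr_ge0 | apply: emeasurable_funM
    | move=> w _; rewrite -EFinM lee_fin mulr_ge0].
rewrite intS intSS integral_cst//= probability_setT mule1.
case: (\int[P]_w _)%E => [x| |]//=.
rewrite -EFinM -!EFinD => -[xE]; rewrite lee_fin.
have nn : (n <= n * n)%N by case: (n) => // k; lia.
rewrite natrB// natrM in xE.
have n0 : 0 <= n%:R :> R by [].
nra.
Qed.

(* The normalised second moments are summable along the squares, and the
   Lipschitz bound on the partial sums fills the gaps between them. *)
Lemma slln_pairwise_independent_events :
  {ae P, forall w, (fun n => (\sum_(i < n) \1_(E i) w) / n%:R) @ \oo --> p}.
Proof.
have p1 : p <= 1 by rewrite -lee_fin -(PE 0) probability_le1.
(* Starting the squares at 1 keeps the denominator nonzero. *)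
pose u k w := (S (k.+1 ^ 2) w - (k.+1 ^ 2)%:R * p) / (k.+1 ^ 2)%:R.
have mu k : measurable_fun setT (fun w => u k w ^+ 2).
  by apply: measurable_funX; apply: measurable_funM => //; exact: measurable_funB.
have u0 k w : (0 <= (u k w ^+ 2)%:E)%E by rewrite lee_fin sqr_ge0.
have intu k : (\int[P]_w (u k w ^+ 2)%:E <= (((k.+1 ^ 2)%:R)^-1)%:E)%E.
  set m := (k.+1 ^ 2)%N.
  have m0 : 0 < m%:R :> R by rewrite ltr0n expn_gt0.
  have -> : (\int[P]_w (u k w ^+ 2)%:E = (m%:R ^- 2)%:E *
              \int[P]_w ((S m w - m%:R * p) ^+ 2)%:E)%E.
    rewrite -ge0_integralZl_EFin//=.
    - by apply: eq_integral => w _; rewrite -EFinM /u exprMn exprVn mulrC.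
    - by move=> w _; rewrite lee_fin sqr_ge0.
    - by apply/measurable_EFinP; apply: measurable_funX; exact: measurable_funB.
  apply: (@le_trans _ _ ((m%:R ^- 2)%:E * m%:R%:E)%E).
    by rewrite lee_pmul2l ?variance_le// lte_fin invr_gt0 exprn_gt0.
  rewrite -EFinM lee_fin expr2 invfM mulfVK ?gt_eqF//.
have int_series : P.-integrable setT (fun w => \sum_(k <oo) (u k w ^+ 2)%:E)%E.
  apply/integrableP; split.
    by apply: ge0_emeasurable_sum => // k _; apply/measurable_EFinP; exact: mu.
  under eq_integral do rewrite gee0_abs ?nneseries_ge0//.
  rewrite integral_nneseries//; last by move=> k; apply/measurable_EFinP; exact: mu.
  apply: (@le_lt_trans _ _ 2%:E); last exact: ltry.
  apply: le_trans (nneseries_inv_sqr_le2 R).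
  by apply: lee_nneseries => [k _ _|k _]; [exact: integral_ge0|exact: intu].
have := integrable_ae measurableT int_series.
apply: filterS => w /(_ I); rewrite ge0_fin_numE ?nneseries_ge0// => /cvg_sum_sqr_0 uw.
have : (fun n => (S n w - n%:R * p) / n%:R) @ \oo --> 0.
  apply: cvg_average_squares => // m n mn.
  have -> : S n w - n%:R * p - (S m w - m%:R * p) =
      \sum_(m <= i < n) (\1_(E i) w - p).
    rewrite sumrB sumr_const_nat -(mulr_natl p) natrB// /S.
    rewrite -!(big_mkord xpredT (fun i => \1_(E i) w)) (big_cat_nat (leq0n m) mn)//=.
    ring.
  (* As 0 <= p <= 1, each centred indicator is at most 1 in absolute value. *)
  apply: (le_trans (ler_norm_sum _ _ _)).
  rewrite -sumr_const_nat ler_sum// => i _.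
  rewrite indicE; case: (_ \in _); rewrite ?sub0r ?normrN ger0_norm//=.
    by rewrite gerBl.
  by rewrite subr_ge0.
move=> /(cvgD (cvg_cst p)); rewrite addr0; apply: cvg_trans.
apply: near_eq_cvg; near=> n.
have n0 : n%:R != 0 :> R by rewrite pnatr_eq0 -lt0n; near: n; exists 1%N.
by rewrite -/(S n w) fctE; field.
Unshelve. all: by end_near. Qed.

End PairwiseIndependentEvents.

(** * Cells of the cube *)

Definition box (R : realType) d (I : 'I_d -> set R) : set (d.-tuple R) :=
  [set x | forall k, I k (tnth x k)].

Lemma measurable_box (R : realType) d (I : 'I_d -> set R) :
  (forall k, measurable (I k)) -> measurable (box I).
Proof.
move=> mI; have -> : box I = \bigcap_(k in [set: 'I_d]) ((@tnth _ _)^~ k @^-1` I k).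
  by apply/seteqP; split => x /= h k; [move=> _|]; apply: h.
apply: fin_bigcap_measurable => // k _.
by rewrite -[X in measurable X]setTI; exact: measurable_tnth.
Qed.

Lemma lebesgue_tuple_set0 (R : realType) d :
  lebesgue_tuple (set0 : set (d.-tuple R)) = 0%E.
Proof.
elim: d => [|d IH] /=; first by rewrite measure0.
by rewrite integral0_eq// => x _; exact: IH.
Qed.

(** Induction on [d]: the slice of a box at [x] is the box of the remaining sides if [x] lies in the
    first side, and is empty otherwise. *)
Lemma lebesgue_tuple_box (R : realType) d (I : 'I_d -> set R) (l : 'I_d -> R) :
  (forall k, measurable (I k)) ->
  (forall k, lebesgue_measure (I k) = (l k)%:E) ->
  lebesgue_tuple (box I) = (\prod_k l k)%:E.
Proof.
elim: d I l => [|d IH] I l mI Il /=.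
  by rewrite big_ord0 diracE mem_set// => -[].
rewrite big_ord_recl EFinM.
pose I' k := I (lift ord0 k).
have tI x : [set y : d.-tuple R | box I [tuple of x :: y]] =
    if x \in I ord0 then box I' else set0.
  apply/seteqP; split => y; case: ifPn => [xI|xI] /=.
  - by move=> h k; have := h (lift ord0 k); rewrite tnthS.
  - by move=> /(_ ord0) h; move: xI; rewrite notin_setE; apply.
  - move=> h k; case: (unliftP ord0 k) => [j ->|->]; first by rewrite tnthS; exact: h.
    by rewrite tnth0; exact: set_mem.
  - by [].
have l0 : (0 <= (\prod_k l (lift ord0 k))%:E)%E.
  by rewrite lee_fin prodr_ge0// => k _; rewrite -lee_fin -Il.
transitivity (\int[@lebesgue_measure R]_x
    ((\prod_k l (lift ord0 k))%:E * (\1_(I ord0) x)%:E))%E.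
  apply: eq_integral => x _; rewrite tI indicE; case: (x \in I ord0).
    by rewrite mule1; apply: IH => k; [exact: mI|exact: Il].
  by rewrite mule0 lebesgue_tuple_set0.
rewrite ge0_integralZl//=; last first.
  by apply/measurable_EFinP; apply: measurable_indic; exact: mI.
have -> : (\int[@lebesgue_measure R]_x (\1_(I ord0) x)%:E = lebesgue_measure (I ord0))%E.
  by rewrite integral_indic ?setIT//; exact: mI.
by rewrite Il muleC.
Qed.

Section Cells.
Variables (R : realType) (d m : nat).
Notation m1 := (m.+1).

(** Half-open intervals, so that those with [a <= m] partition [-1, 1) exactly. *)
Definition cell_itv (a : nat) : set R :=
  [set` `[2 * a%:R / m1%:R - 1, 2 * a.+1%:R / m1%:R - 1[].

Definition cell (c : {ffun 'I_d -> 'I_m1}) : set (d.-tuple R) :=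
  box (fun k => cell_itv (c k)).

(** Meaningful only for coordinates in [-1, 1); elsewhere truncation or [inord] falls back on 0. *)
Definition cell_index (x : d.-tuple R) : {ffun 'I_d -> 'I_m1} :=
  [ffun k => inord (Num.truncn ((tnth x k + 1) * m1%:R / 2))].

Lemma cell_itvE a t :
  cell_itv a t <-> a%:R <= (t + 1) * m1%:R / 2 < a.+1%:R.
Proof.
rewrite /cell_itv /= in_itv/= lerBlDr ltrBrDr.
by rewrite ler_pdivrMr// ltr_pdivlMr// ler_pdivlMr// ltr_pdivrMr// ![_ * 2]mulrC.
Qed.

Lemma cell_itv_range a t : (a <= m)%N -> cell_itv a t -> -1 <= t < 1.
Proof.
rewrite -ltnS => am /cell_itvE/andP[at1 ta].
have m0 : 0 < m1%:R :> R by [].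
have ta' : (t + 1) * m1%:R / 2 < m1%:R by rewrite (lt_le_trans ta)// ler_nat.
have a0 : 0 <= a%:R :> R by [].
apply/andP; split.
  have : 0 <= (t + 1) * m1%:R by lra.
  by rewrite pmulr_lge0//; lra.
have : (t + 1) * m1%:R < 2 * m1%:R by lra.
by rewrite ltr_pM2r//; lra.
Qed.

Lemma cell_indexP (x : d.-tuple R) c :
  (forall k, -1 <= tnth x k < 1) -> cell c x <-> cell_index x = c.
Proof.
move=> x1; split=> [xc|<- k].
  apply/ffunP => k; rewrite ffunE; apply: val_inj.
  have /cell_itvE := xc k.
  move=> h; rewrite (truncn_def h); exact: inordK.

apply/cell_itvE; rewrite ffunE.
have /andP[h1 h2] := x1 k.
have t0 : 0 <= (tnth x k + 1) * m1%:R / 2 by rewrite divr_ge0// mulr_ge0//; lra.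
rewrite inordK ?truncn_itv//.
rewrite -(ltr_nat R) (le_lt_trans (_ : _ <= (tnth x k + 1) * m1%:R / 2))//.
  by rewrite truncn_le.
have m0 : 0 < m1%:R :> R by [].
nra.
Qed.

Lemma measurable_cell c : measurable (cell c).
Proof. by apply: measurable_box => k; exact: measurable_itv. Qed.

Lemma lebesgue_tuple_cell c : lebesgue_tuple (cell c) = ((2 / m1%:R) ^+ d)%:E.
Proof.
rewrite (@lebesgue_tuple_box _ _ _ (fun _ => 2 / m1%:R)).
- by rewrite prodr_const card_ord.
- by move=> k; exact: measurable_itv.
- move=> k; rewrite lebesgue_measure_itv/= lte_fin.
  rewrite ltrD2r ltr_pM2r ?invr_gt0// ltr_pM2l// ltr_nat ltnSn.
  by rewrite -EFinD; congr (_%:E); rewrite -natr1; field.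
Qed.

Lemma cell_sub_cube c : cell c `<=` @cube R d.
Proof.
move=> x xc k; have := cell_itv_range (ltn_ord (c k)) (xc k).
by move=> /andP[-> /ltW ->].
Qed.

End Cells.

Lemma lebesgue_tuple_cube (R : realType) d :
  lebesgue_tuple (@cube R d) = (2 ^+ d)%:E.
Proof.
have -> : @cube R d = box (fun _ => [set` `[-1, 1]]).
  by apply/seteqP; split => x h k; have := h k; rewrite /= in_itv.
rewrite (@lebesgue_tuple_box _ _ _ (fun _ => 2)).
- by rewrite prodr_const card_ord.
- by move=> k; exact: measurable_itv.
- move=> k; rewrite lebesgue_measure_itv/= lte_fin ifT; last by lra.
  by rewrite -EFinD opprK.
Qed.

(** * Cell frequencies of the uniform sample *)

Section UniformSample.
Context (R : realType) (disp : measure_display) (T : measurableType disp)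
  (P : probability T R) (d : nat) (X : nat -> {RV P >-> d.-tuple R}).
Hypothesis hX : iid_uniform_on_cube X.

Lemma probability_cell m i (c : {ffun 'I_d -> 'I_m.+1}) :
  P (X i @^-1` cell c) = ((m.+1%:R ^-1) ^+ d)%:E.
Proof.
have := hX.2 i _ (measurable_cell c).
rewrite /distribution /pushforward => ->.
rewrite (setIidl (@cell_sub_cube R d m c)) lebesgue_tuple_cell lebesgue_tuple_cube.
rewrite inver expf_eq0 pnatr_eq0 andbF -EFinM -expr_div_n; congr ((_ ^+ _)%:E).
by field.
Qed.

Lemma measurable_preimage_cell m i (c : {ffun 'I_d -> 'I_m.+1}) :
  measurable (X i @^-1` cell c).
Proof. by rewrite -[X in measurable X]setTI; apply: measurable_funP => //; exact: measurable_cell. Qed.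

Lemma ae_sample_in_cube :
  {ae P, forall w, forall i k, -1 <= tnth (X i w) k < 1}.
Proof.
apply: ae_foralln => i.
(* With one interval per axis the only cell is [-1, 1)^d, of probability 1. *)
pose c : {ffun 'I_d -> 'I_1} := [ffun => ord0].
exists (~` (X i @^-1` cell c)); split.
- by apply: measurableC; exact: measurable_preimage_cell.
- apply: etrans (probability_setC P (measurable_preimage_cell i c)) _.
  rewrite probability_cell.
  by rewrite invr1 expr1n subee.
- move=> w /= nw wc; apply: nw => k.
  by apply: cell_itv_range (wc k); rewrite ffunE.
Qed.

(** For a fixed cell, the events that [X i] falls in it are pairwise independent and equally likely,
    so the law of large numbers applies; finitely many null sets are then joined. *)
Lemma ae_cell_frequency m :
  {ae P, forall w, forall c : {ffun 'I_d -> 'I_m.+1},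
    (fun n => (\sum_(i < n) (cell_index m (X i w) == c)%:R) / n%:R : R) @ \oo -->
    ((m.+1%:R ^-1) ^+ d : R)}.
Proof.
apply: filter_forall => c.
pose E i := X i @^-1` cell c.
have PEE i j : i != j -> P (E i `&` E j) = (((m.+1%:R ^-1) ^+ d : R) ^+ 2)%:E.
  move=> ij.
  have := hX.1 [:: i; j] (fun _ => cell c).
  rewrite /= inE ij => /(_ isT (fun _ => measurable_cell c)).
  rewrite !big_cons big_nil mule1 -!/(E _) !probability_cell -EFinM => <-.
  congr (P _); apply/seteqP; split => w /=.
    by move=> [wi wj] k /=; rewrite !inE => /orP[] /eqP ->.
  by move=> h; split; apply: h; rewrite /= !inE eqxx ?orbT.
have := slln_pairwise_independent_events
  (fun i => measurable_preimage_cell i c) (fun i => probability_cell i c) PEE.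
move: ae_sample_in_cube; apply: filterS2 => w w1.
apply: cvg_trans; apply: near_eq_cvg; near=> n.
congr (_ / _); apply: eq_bigr => i _; rewrite indicE; congr (_%:R).
congr nat_of_bool; apply/idP/eqP.
  by rewrite inE => /cell_indexP; apply.
by move=> xc; rewrite inE; apply/cell_indexP => //; exact: w1.
Unshelve. all: by end_near. Qed.

End UniformSample.

(** * Sums over the grid of cells *)

(** The relation |a - b| <= l, free of truncated subtraction. *)
Definition near_idx (l a b : nat) : bool := (a <= b + l)%N && (b <= a + l)%N.

(** The window from a - l to a + l is cut at 0 by truncated subtraction and at the far end by
    [minn]. *)
Lemma sum_near_idx (R : realFieldType) m l a (F : nat -> R) :
  \sum_(b < m) (near_idx l a b)%:R * F b =
  \sum_(a - l <= b < minn m (a + l).+1) F b.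
Proof.
rewrite -(big_mkord xpredT (fun b => (near_idx l a b)%:R * F b)).
rewrite [RHS](big_nat_widen _ _ m) ?geq_minl// [RHS](big_nat_widenl _ 0)//= [RHS]big_mkcond/=.
apply: eq_big_nat => b /andP[_ bm].
rewrite (_ : _ && _ = near_idx l a b); last first.
  by rewrite /near_idx; lia.
by case: near_idx; rewrite ?mul1r ?mul0r.
Qed.

Lemma sum_near_idx1 (R : realFieldType) m l a :
  \sum_(b < m) (near_idx l a b)%:R = (minn m (a + l).+1 - (a - l))%:R :> R.
Proof.
under eq_bigr do rewrite -[_%:R]mulr1.
by rewrite (sum_near_idx m l a (fun=> 1)) sumr_const_nat.
Qed.

(** If one side of the window is uncut, it makes [l.+1] cells together with [a]; otherwise the
    window is the whole range of m > l cells. *)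
Lemma sum_near_idx_ge (R : realFieldType) m l a : (a < m)%N -> (l < m)%N ->
  l.+1%:R <= \sum_(b < m) (near_idx l a b)%:R :> R.
Proof. by move=> am lm; rewrite sum_near_idx1 ler_nat; lia. Qed.

Lemma sum_near_idx_diff (R : realFieldType) m l a : (a < m)%N ->
  \sum_(b < m) ((near_idx l.+2 a b)%:R - (near_idx l a b)%:R) <= 4 :> R.
Proof.
by move=> am; rewrite sumrB !sum_near_idx1 lerBlDr -natrD ler_nat; lia.
Qed.

(** Centre of cell [a] among [m] equal cells of [-1, 1]. Here [m] counts the cells, whereas
    [cell_itv m] belongs to a grid of [m.+1]. *)
Definition midpoint (R : realFieldType) (m a : nat) : R :=
  (2 * a%:R + 1 - m%:R) / m%:R.

Lemma sum_odd_range (R : realFieldType) (lo n : nat) :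
  \sum_(lo <= b < lo + n) (2 * b%:R + 1) = n%:R * (2 * lo%:R + n%:R) :> R.
Proof.
elim: n => [|n IH]; first by rewrite addn0 big_geq// mul0r.
by rewrite addnS big_nat_recr ?leq_addr//= IH natrD -natr1; ring.
Qed.

(* Discrete form of the fact that the walk moves the first coordinate from [x]
   to the midpoint of [x - r, x + r] cut by [-1, 1], which for [0 <= x] is
   [x] or [(x + 1 - r) / 2]. *)
Lemma midpoint_drift (R : realFieldType) (r : R) m l a : (a < m)%N -> r < 1 ->
  2 * l.+1%:R <= r * m%:R ->
  (1 - r) * l.+1%:R * midpoint R m a ^+ 2 <=
  midpoint R m a *
    \sum_(b < m) (near_idx l a b)%:R * (2 * midpoint R m b - midpoint R m a).
Proof.
move=> am r1 lr.
have m0 : 0 < m%:R :> R by rewrite ltr0n; lia.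
have r0 : 0 < r by rewrite -(pmulr_lgt0 _ m0) (lt_le_trans _ lr)// mulr_gt0.
(* The full window is shorter than the range, so at most one of its ends is cut. *)
have lm : (2 * l.+1 < m)%N.
  by rewrite -(ltr_nat R) natrM (le_lt_trans lr)// gtr_pMl.
rewrite (sum_near_idx m l a (fun b => 2 * midpoint R m b - midpoint R m a)).
set lo := (a - l)%N; set hi := minn m (a + l).+1.
have [n hiE] : exists n, hi = (lo + n)%N by exists (hi - lo)%N; lia.
have -> : \sum_(lo <= b < hi) (2 * midpoint R m b - midpoint R m a) =
    n%:R * (2 * (lo + hi)%:R - m%:R - 2 * a%:R - 1) / m%:R.
  rewrite hiE (eq_bigr (fun b => (2 / m%:R) * (2 * b%:R + 1) - (2 + midpoint R m a))).
    rewrite sumrB -mulr_sumr sum_odd_range sumr_const_nat addKn -mulr_natl.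
    by rewrite !natrD /midpoint; field; rewrite gt_eqF.
  by move=> b _; rewrite /midpoint; field; rewrite gt_eqF.
rewrite /midpoint; set y := 2 * a%:R + 1 - m%:R.
suff H : (1 - r) * l.+1%:R * y ^+ 2 <=
    y * (n%:R * (2 * (lo + hi)%:R - m%:R - 2 * a%:R - 1)).
  rewrite exprMn exprVn mulrA ler_pdivrMr ?exprn_gt0//.
  suff -> : y / m%:R * (n%:R * (2 * (lo + hi)%:R - m%:R - 2 * a%:R - 1) / m%:R) * m%:R ^+ 2
     = y * (n%:R * (2 * (lo + hi)%:R - m%:R - 2 * a%:R - 1)) by [].
  by field; rewrite gt_eqF.
have nl : l.+1%:R <= n%:R :> R by rewrite ler_nat; lia.
have l0 : 0 < l.+1%:R :> R by [].
suff H : (1 - r) * y ^+ 2 <= y * (2 * (lo + hi)%:R - m%:R - 2 * a%:R - 1).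
  have y0 : 0 <= (1 - r) * y ^+ 2 by rewrite mulr_ge0 ?sqr_ge0// subr_ge0 ltW.
  by nra.
have l1 : l.+1%:R = l%:R + 1 :> R by rewrite natr1.
have y2 := sqr_ge0 y.
(* Window cut on the left, where y <= 0. *)
have [left|nleft] := ltnP a l.
  have -> : (2 * (lo + hi)%:R - m%:R - 2 * a%:R - 1) = 2 * l%:R + 1 - m%:R :> R.
    have -> : (lo + hi)%N = (a + l + 1)%N by lia.
    by rewrite !natrD; ring.
  have al : 2 * a%:R + 1 <= m%:R :> R by rewrite -natrM natr1 ler_nat; lia.
  have a0 : 0 <= a%:R :> R by [].
  have yE : y = 2 * a%:R + 1 - m%:R by [].
  have h1 : (1 - r) * y >= 2 * l%:R + 1 - m%:R by nra.
  have y0 : y <= 0 by lra.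
  nra.
(* Uncut window: it is symmetric about [a], so the bracket is [y] itself. The remaining case is the
   cut on the right, where y >= 0. *)
have [right|nright] := ltnP (a + l) m.
  have -> : (2 * (lo + hi)%:R - m%:R - 2 * a%:R - 1) = y.
    have -> : (lo + hi)%N = (2 * a + 1)%N by lia.
    by rewrite /y natrD natrM; ring.
  nra.
have -> : (2 * (lo + hi)%:R - m%:R - 2 * a%:R - 1) = m%:R - 2 * l%:R - 1 :> R.
  have -> : (lo + hi)%N = (a - l + m)%N by lia.
  by rewrite natrD natrB//; ring.
have al : m%:R <= 2 * a%:R + 1 :> R by rewrite -natrM natr1 ler_nat; lia.
have a0 : a%:R <= m%:R - 1 :> R by rewrite lerBrDr natr1 ler_nat.
have yE : y = 2 * a%:R + 1 - m%:R by [].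
have h1 : (1 - r) * y <= m%:R - 2 * l%:R - 1 by nra.
have y0 : 0 <= y by lra.
nra.
Qed.

(** The exact value is (m^2 - 1) / (3 m), which equals m / 4 at m = 2. *)
Lemma sum_midpoint_sqr (R : realFieldType) m : (1 < m)%N ->
  m%:R / 4 <= \sum_(a < m) midpoint R m a ^+ 2.
Proof.
move=> m1.
(* The shift [k] is kept apart from the range [n] for the induction; both become [m] afterwards. *)
have E (k : R) n : \sum_(a < n) (2 * a%:R + 1 - k) ^+ 2 =
    n%:R * (4 * n%:R ^+ 2 - 1) / 3 - 2 * k * n%:R ^+ 2 + n%:R * k ^+ 2.
  elim: n => [|n IH]; first by rewrite big_ord0; field.
  by rewrite big_ord_recr/= IH -natr1; field.
have m2 : 2 <= m%:R :> R by rewrite ler_nat.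
have m0 : 0 < m%:R :> R by lra.
under eq_bigr do rewrite /midpoint exprMn.
rewrite -mulr_suml E exprVn ler_pdivlMr ?exprn_gt0//.
nra.
Qed.

Lemma sum_ffun_coord (R : comNzRingType) (I J : finType) (k : I) (F : J -> R) :
  \sum_(c : {ffun I -> J}) F (c k) = #|J|%:R ^+ #|I|.-1 * \sum_b F b.
Proof.
pose G j b := if j == k then F b else 1.
have E (c : {ffun I -> J}) : F (c k) = \prod_j G j (c j).
  by rewrite (bigD1 k)//= /G eqxx big1 ?mulr1// => j /negPf ->.
under eq_bigr do rewrite E.
rewrite -bigA_distr_bigA (bigD1 k)//= {1}/G eqxx mulrC; congr (_ * _).
rewrite (eq_bigr (fun _ => #|J|%:R)); first by rewrite prodr_const cardC1.
by move=> j /negPf jk; rewrite /G jk sumr_const.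
Qed.

Section Grid.
Variables (R : realFieldType) (d m : nat).
Notation grid := {ffun 'I_d.+1 -> 'I_m}.
Implicit Types (c : grid) (l : nat).

(** An indicator written as a product, so that sums over [c'] factor over the coordinates. *)
Definition grid_near l c c' : R := \prod_k (near_idx l (c k) (c' k))%:R.

Definition grid_mid c : R := midpoint R m (c ord0).

Lemma grid_nearE l c c' : grid_near l c c' = [forall k, near_idx l (c k) (c' k)]%:R.
Proof.
rewrite /grid_near; case: (boolP [forall k, _]) => [/forallP h|].
  by rewrite big1// => k _; rewrite h.
by move=> /forallPn[k /negPf h]; rewrite (bigD1 k)//= h mul0r.
Qed.

Lemma grid_near_le1 l c c' : grid_near l c c' <= 1.
Proof. by rewrite grid_nearE lern1 leq_b1. Qed.

Lemma near_idx_mono l l' a b : (l <= l')%N -> near_idx l a b -> near_idx l' a b.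
Proof. by rewrite /near_idx; lia. Qed.

Lemma grid_near_mono l l' c c' : (l <= l')%N -> grid_near l c c' <= grid_near l' c c'.
Proof.
move=> ll; apply: ler_prod => k _; rewrite ler0n ler_nat/=.
by case: (boolP (near_idx l _ _)) => // /(near_idx_mono ll) ->.
Qed.

Lemma card_grid : #|{: grid}| = (m ^ d.+1)%N.
Proof. by rewrite card_ffun !card_ord. Qed.

Lemma sum_grid_near_row_ge l c : (l < m)%N ->
  l.+1%:R ^+ d.+1 <= \sum_c' grid_near l c c'.
Proof.
move=> lm; rewrite -(bigA_distr_bigA (fun k (b : 'I_m) => (near_idx l (c k) b)%:R)).
rewrite -[X in _ ^+ X](card_ord d.+1) -prodr_const.
by apply: ler_prod => k _; rewrite ler0n/=; exact: sum_near_idx_ge.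
Qed.

Lemma sum_grid_near_ge l : (l < m)%N ->
  m%:R ^+ d.+1 * l.+1%:R ^+ d.+1 <= \sum_c \sum_c' grid_near l c c'.
Proof.
move=> lm; rewrite -natrX -card_grid mulr_natl -sumr_const.
by apply: ler_sum => c _; exact: sum_grid_near_row_ge.
Qed.

Lemma sum_grid_near_le l :
  \sum_c \sum_c' grid_near l c c' <= (m%:R ^+ d.+1) ^+ 2.
Proof.
rewrite expr2 -natrX -card_grid mulr_natl -sumr_const; apply: ler_sum => c _.
by rewrite -[leRHS]sumr_const; apply: ler_sum => c' _; exact: grid_near_le1.
Qed.

(** Reversing all coordinates preserves nearness and changes the sign of [grid_mid]. *)
Lemma sum_grid_near_mid l : \sum_c \sum_c' grid_near l c c' * grid_mid c = 0.
Proof.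
pose rv c : grid := [ffun k => rev_ord (c k)].
have rvK : involutive rv by move=> c; apply/ffunP => k; rewrite !ffunE rev_ordK.
set s := LHS; suff : s = - s by move=> E; lra.
rewrite {1}/s (reindex_inj (inv_inj rvK)) /s -sumrN; apply: eq_bigr => c _.
rewrite (reindex_inj (inv_inj rvK)) -sumrN; apply: eq_bigr => c' _.
rewrite -mulrN; congr (_ * _).
  apply: eq_bigr => k _; congr (nat_of_bool _)%:R; rewrite !ffunE /near_idx/=.
  by move: (c k) (c' k) => [a am] [b bm] /=; lia.
rewrite /grid_mid /midpoint ffunE/= natrB// -natr1.
by rewrite -mulNr; congr (_ / _); ring.
Qed.

Lemma sum_grid_mid_sqr : (1 < m)%N ->
  m%:R ^+ d.+1 / 4 <= \sum_c grid_mid c ^+ 2.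
Proof.
move=> m1; rewrite (sum_ffun_coord ord0 (fun b : 'I_m => midpoint R m b ^+ 2)).
rewrite !card_ord/= exprSr -mulrA ler_wpM2l ?exprn_ge0//.
exact: sum_midpoint_sqr.
Qed.

(** For fixed [c] the inner sum factors over coordinates: the first is bounded by [midpoint_drift],
    each other one is at least [l.+1]. *)
Lemma grid_drift l (r : R) : r < 1 -> 2 * l.+1%:R <= r * m%:R -> (1 < m)%N ->
  (1 - r) * l.+1%:R ^+ d.+1 * (m%:R ^+ d.+1 / 4) <=
  \sum_c \sum_c' grid_near l c c' * (2 * grid_mid c * grid_mid c' - grid_mid c ^+ 2).
Proof.
move=> r1 lr m1.
have m0 : 0 < m%:R :> R by rewrite ltr0n ltnW.
have lm : (l < m)%N.
  have lr' : l.+1%:R <= r * m%:R :> R by apply: le_trans lr; rewrite ler_peMl// ler1n.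
  by rewrite ltnW// -(ltr_nat R) (le_lt_trans lr')// gtr_pMl.
have l0 : 0 <= (1 - r) * l.+1%:R ^+ d.+1.
  by rewrite mulr_ge0 ?exprn_ge0// subr_ge0 ltW.
apply: (le_trans (ler_wpM2l l0 (sum_grid_mid_sqr m1))).
rewrite mulr_sumr; apply: ler_sum => c _.
pose G k (b : 'I_m) := (near_idx l (c k) b)%:R *
  (if k == ord0 then 2 * midpoint R m b - grid_mid c else 1).
have -> : \sum_c' grid_near l c c' * (2 * grid_mid c * grid_mid c' - grid_mid c ^+ 2)
    = grid_mid c * \sum_(c' : grid) \prod_k G k (c' k).
  rewrite mulr_sumr; apply: eq_bigr => c' _.
  rewrite big_split/= -/(grid_near l c c').
  have -> : \prod_k (if k == ord0 then 2 * midpoint R m (c' k) - grid_mid c else 1) =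
      2 * grid_mid c' - grid_mid c.
    by rewrite (bigD1 ord0)//= big1 ?mulr1// => k /negPf ->.
  ring.
rewrite -bigA_distr_bigA big_ord_recl/= {1}/G/= mulrA.
have -> : (1 - r) * l.+1%:R ^+ d.+1 * grid_mid c ^+ 2 =
    (1 - r) * l.+1%:R * grid_mid c ^+ 2 * l.+1%:R ^+ d by rewrite exprS; ring.
apply: ler_pM; rewrite ?exprn_ge0//.
- by rewrite mulr_ge0 ?sqr_ge0// mulr_ge0// subr_ge0 ltW.
- exact: midpoint_drift.
rewrite -[X in _ ^+ X](card_ord d) -prodr_const; apply: ler_prod => k _.
rewrite ler0n/= /G/=; under eq_bigr do rewrite mulr1.
exact: sum_near_idx_ge.
Qed.

(** Union bound: a pair near at [l.+2] but not at [l] has a coordinate in the added margin, which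
    holds at most 4 indices. *)
Lemma sum_grid_near_diff l :
  \sum_c \sum_c' (grid_near l.+2 c c' - grid_near l c c') <=
  4 * d.+1%:R * m%:R ^+ d * m%:R ^+ d.+1.
Proof.
have le_sum c c' : grid_near l.+2 c c' - grid_near l c c' <=
    \sum_k ((near_idx l.+2 (c k) (c' k))%:R - (near_idx l (c k) (c' k))%:R).
  have ge0 k : 0 <= (near_idx l.+2 (c k) (c' k))%:R - (near_idx l (c k) (c' k))%:R :> R.
    rewrite subr_ge0 ler_nat.
    by case: (boolP (near_idx l _ _)) => // h; rewrite (near_idx_mono _ h)// ltnW.
  rewrite !grid_nearE.
  case: (boolP [forall k, near_idx l.+2 _ _]) => [/forallP h2|_]; last first.
    by apply: le_trans (sumr_ge0 _ (fun k _ => ge0 k)); rewrite sub0r oppr_le0.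
  case: (boolP [forall k, near_idx l _ _]) => [_|/forallPn[k /negPf h]].
    by rewrite subrr sumr_ge0.
  rewrite subr0 (bigD1 k)//= h h2 subr0 lerDl.
  by apply: sumr_ge0.
rewrite -[m%:R ^+ d.+1]natrX -card_grid mulr_natr -sumr_const; apply: ler_sum => c _.
apply: (le_trans (ler_sum _ (fun c' _ => le_sum c c'))).
rewrite exchange_big/= mulrAC mulr_natr -[X in _ *+ X](card_ord d.+1) -sumr_const.
apply: ler_sum => k _.
rewrite (sum_ffun_coord k (fun b : 'I_m => (near_idx l.+2 (c k) b)%:R - (near_idx l (c k) b)%:R)).
by rewrite !card_ord/= mulrC ler_wpM2r ?exprn_ge0// sum_near_idx_diff.
Qed.

End Grid.

(** * From the grid to the sample *)

(** Grouping the pairs by their values turns the average into a finite sum of products of two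
    frequencies. *)
Lemma cvg_mean_pairs (R : realType) (C : finType) (c : nat -> C) (q : R)
    (G : C -> C -> R) :
  (forall g, (fun n => (\sum_(i < n) (c i == g)%:R) / n%:R : R) @ \oo --> q) ->
  (fun n => (\sum_(i < n) \sum_(j < n) G (c i) (c j)) / n%:R ^+ 2) @ \oo -->
  q ^+ 2 * \sum_g \sum_h G g h.
Proof.
move=> cq; pose f g n : R := (\sum_(i < n) (c i == g)%:R) / n%:R.
have -> : (fun n => (\sum_(i < n) \sum_(j < n) G (c i) (c j)) / n%:R ^+ 2) =
    (fun n => \sum_g \sum_h f g n * f h n * G g h).
  apply/funext => n.
  have E (F : C -> R) : \sum_(i < n) F (c i) = \sum_g (\sum_(i < n) (c i == g)%:R) * F g.
    under [RHS]eq_bigr do rewrite mulr_suml.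
    rewrite exchange_big/=; apply: eq_bigr => i _.
    rewrite (bigD1 (c i))//= eqxx mul1r big1 ?addr0// => g /negPf.
    by rewrite eq_sym => ->; rewrite mul0r.
  rewrite (E (fun g => \sum_(j < n) G g (c j))) mulr_suml; apply: eq_bigr => g _.
  rewrite (E (G g)) mulr_sumr mulr_suml; apply: eq_bigr => h _.
  by rewrite /f expr2 invfM; ring.
rewrite mulr_sumr; apply: cvg_big => [|g _]; first exact: add_continuous.
rewrite mulr_sumr; apply: cvg_big => [|h _]; first exact: add_continuous.
by apply: cvgMr_tmp; rewrite expr2; apply: cvgM; exact: cq.
Qed.

Lemma supdist_leP (R : realType) d (x y : d.-tuple R) (r : R) : 0 <= r ->
  reflect (forall k, `|tnth x k - tnth y k| <= r) (supdist x y <= r).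
Proof.
move=> r0; apply: (iffP (bigmax_leP _ _ _ _)) => [[_ h] k|h]; first exact: h.
by split.
Qed.

Section CellAdjacency.
Variables (R : realType) (d m L : nat) (r : R).
Hypotheses (r0 : 0 < r) (lr : 2 * L.+1%:R <= r * m.+1%:R)
  (rl : r * m.+1%:R < 2 * L.+2%:R).

Let mR0 : 0 < m.+1%:R :> R. Proof. by []. Qed.

(** Points in cells with index gap at most [L] are less than [L.+1] cell widths apart, and by [lr]
    that many widths fit in [r]. *)
Lemma near_idx_dist a b (t s : R) : cell_itv m a t -> cell_itv m b s ->
  near_idx L a b -> `|t - s| <= r.
Proof.
move=> /cell_itvE/andP[a1 a2] /cell_itvE/andP[b1 b2] /andP[].
rewrite -!(ler_nat R) !natrD => ab ba.
rewrite -[a.+1%:R]natr1 in a2; rewrite -[b.+1%:R]natr1 in b2.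
have := lr; rewrite -[L.+1%:R]natr1 => lr'.
have M0 := mR0.
rewrite ler_norml; apply/andP; split; nra.
Qed.

(** By [rl] the distance is below [L.+2] widths; the positions inside the cells add less than one
    more, so the index gap is below [L.+3]. *)
Lemma dist_near_idx a b (t s : R) : cell_itv m a t -> cell_itv m b s ->
  `|t - s| <= r -> near_idx L.+2 a b.
Proof.
move=> /cell_itvE/andP[a1 a2] /cell_itvE/andP[b1 b2].
rewrite ler_norml => /andP[ts1 ts2].
rewrite -[a.+1%:R]natr1 in a2; rewrite -[b.+1%:R]natr1 in b2.
have M0 := mR0; have := rl; rewrite -[L.+2%:R]natr1 -[L.+1%:R]natr1 => rl'.
apply/andP; split; rewrite -ltnS -(ltr_nat R) -[(_ + _).+1%:R]natr1 natrD
  -[L.+2%:R]natr1 -[L.+1%:R]natr1; nra.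
Qed.

Lemma grid_near_supdist (x y : d.+1.-tuple R) :
  (forall k, -1 <= tnth x k < 1) -> (forall k, -1 <= tnth y k < 1) ->
  grid_near R L (cell_index m x) (cell_index m y) <= (supdist x y <= r)%R%:R
    <= grid_near R L.+2 (cell_index m x) (cell_index m y).
Proof.
move=> x1 y1.
have xc : cell (cell_index m x) x by apply/cell_indexP.
have yc : cell (cell_index m y) y by apply/cell_indexP.
rewrite !grid_nearE !ler_nat.
apply/andP; split.
  case: (boolP [forall k, _]) => // /forallP h.
  rewrite (_ : _ <= r)//; apply/supdist_leP; first exact: ltW.
  by move=> k; apply: near_idx_dist (xc k) (yc k) (h k).
case: supdist_leP; rewrite ?(ltW r0)// => h.
rewrite (_ : [forall k, _])//; apply/forallP => k.
exact: dist_near_idx (xc k) (yc k) (h k).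
Qed.

End CellAdjacency.

Lemma midpoint_norm_le1 (R : realFieldType) m a : (a < m)%N ->
  `|midpoint R m a| <= 1.
Proof.
move=> am; have m0 : 0 < m%:R :> R by rewrite ltr0n (leq_ltn_trans _ am).
have am' : a%:R + 1 <= m%:R :> R by rewrite natr1 ler_nat.
have a0 : 0 <= a%:R :> R by [].
rewrite ler_norml /midpoint ler_pdivlMr// ler_pdivrMr//.
by apply/andP; split; lra.
Qed.

(** Replacing [lo] by [A] costs at most the total gap between [up] and [lo] in the linear term, and
    at most three times that gap in the quadratic one. *)
Lemma sandwich_determinant_gt0 (R : realFieldType) n (A lo up : 'I_n -> 'I_n -> R)
    (f : 'I_n -> R) :
  (forall i j, lo i j <= A i j <= up i j) -> (forall i, `|f i| <= 1) ->
  0 < \sum_i \sum_j lo i j ->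
  (`|\sum_i \sum_j lo i j * f i| + \sum_i \sum_j (up i j - lo i j)) ^+ 2 <
    (\sum_i \sum_j lo i j) *
    (\sum_i \sum_j lo i j * (2 * f i * f j - f i ^+ 2)
     - 3 * \sum_i \sum_j (up i j - lo i j)) ->
  0 < \sum_i \sum_j A i j /\
  (\sum_i \sum_j A i j * f i) ^+ 2 <
    (\sum_i \sum_j A i j) * \sum_i \sum_j A i j * (2 * f i * f j - f i ^+ 2).
Proof.
move=> loA f1; set p := \sum_i \sum_j lo i j.
set e := \sum_i _; set D := \sum_i \sum_j (up i j - lo i j); set g := \sum_i _.
move=> p0 He.
have pA : p <= \sum_i \sum_j A i j.
  by apply: ler_sum => i _; apply: ler_sum => j _; case/andP: (loA i j).
split; first exact: lt_le_trans pA.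
have D0 : 0 <= D.
  apply: sumr_ge0 => i _; apply: sumr_ge0 => j _; have := loA i j; lra.
have gA : g - 3 * D <= \sum_i \sum_j A i j * (2 * f i * f j - f i ^+ 2).
  rewrite mulr_sumr -sumrB; apply: ler_sum => i _.
  rewrite mulr_sumr -sumrB; apply: ler_sum => j _.
  have := f1 i; have := f1 j; rewrite !ler_norml => /andP[j1 j2] /andP[i1 i2].
  have /andP[A1 A2] := loA i j.
  set w := 2 * f i * f j - f i ^+ 2.
  (* Since |f| <= 1, the product contributes at least -2 and the square at least -1. *)
  have w3 : -3 <= w by rewrite /w; nra.
  nra.
have eA : `|\sum_i \sum_j A i j * f i| <= `|e| + D.
  have -> : \sum_i \sum_j A i j * f i = e + \sum_i \sum_j (A i j - lo i j) * f i.
    rewrite -big_split; apply: eq_bigr => i _; rewrite -big_split.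
    by apply: eq_bigr => j _ /=; ring.
  rewrite (le_trans (ler_normD _ _))// lerD2l.
  rewrite (le_trans (ler_norm_sum _ _ _))//; apply: ler_sum => i _.
  rewrite (le_trans (ler_norm_sum _ _ _))//; apply: ler_sum => j _.
  have /andP[A1 A2] := loA i j.
  rewrite normrM ger0_norm ?subr_ge0//.
  by rewrite (le_trans (ler_piMr _ (f1 i))) ?subr_ge0// lerD2r.
rewrite -real_normK ?num_real//.
apply: (@le_lt_trans _ _ ((`|e| + D) ^+ 2)).
  by rewrite ler_sqr ?nnegrE// addr_ge0.
apply: (lt_le_trans He).
have gD : 0 <= g - 3 * D.
  by rewrite -(pmulr_rge0 _ p0) (le_trans _ (ltW He))// sqr_ge0.
by apply: ler_pM => //; exact: ltW.
Qed.

(** * Choice of the grid and passage to the limit *)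

Lemma exists_fine_grid (R : realType) (r K : R) : 0 < r ->
  exists m L : nat, [/\ K < m.+1%:R, 2 * L.+1%:R <= r * m.+1%:R,
    r * m.+1%:R < 2 * L.+2%:R & r / 4 <= L.+1%:R / m.+1%:R].
Proof.
(* The first summand puts [m] above [K]; the second makes r (m + 1) exceed 4, which gives a positive
   floor below and the final bound r / 4. *)
move=> r0; pose M := Num.max 0 K + 4 / r.
have M0 : 0 <= M by rewrite addr_ge0 ?le_max ?lexx// divr_ge0 ?ltW.
have := archi_boundP M0; set m := Num.bound M => Mm.
have mr : 4 < r * m.+1%:R.
  rewrite mulrC -ltr_pdivrMr// (lt_trans _ (_ : m%:R < _)) ?ltr_nat//.
  by rewrite (le_lt_trans _ Mm)// lerDr le_max lexx.
(* [L.+1] is the number of whole cell widths in [r]. *)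
pose L := (Num.truncn (r * m.+1%:R / 2)).-1.
have h0 : 0 <= r * m.+1%:R / 2 by lra.
have /andP[t1 t2] := truncn_itv h0.
have L1 : L.+1 = Num.truncn (r * m.+1%:R / 2).
  rewrite prednK//; rewrite truncn_gt0; lra.
rewrite -L1 in t1 t2.
exists m, L; split; [|lra|lra|].
  rewrite (lt_trans _ (_ : m%:R < _)) ?ltr_nat// (le_lt_trans _ Mm)//.
  have : K <= Num.max 0 K by rewrite le_max lexx orbT.
  have : 0 < 4 / r by rewrite divr_gt0.
  by rewrite /M; lra.
rewrite ler_pdivlMr//; rewrite -natr1 in t2; lra.
Qed.

Lemma cvg_eventually_gt0 (R : realType) (p e g D : nat -> R) (p' g' D' : R) :
  p @ \oo --> p' -> e @ \oo --> 0 -> g @ \oo --> g' -> D @ \oo --> D' ->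
  0 < p' -> D' ^+ 2 < p' * (g' - 3 * D') ->
  \forall n \near \oo, 0 < p n /\ (`|e n| + D n) ^+ 2 < p n * (g n - 3 * D n).
Proof.
move=> pp ee gg DD p0 H.
have e0 : (fun n => `|e n|) @ \oo --> (0 : R) by rewrite -(normr0 R); exact: cvg_norm.
have eD : (fun n => `|e n| + D n) @ \oo --> 0 + D' by exact: cvgD.
have gD : (fun n => g n - 3 * D n) @ \oo --> g' - 3 * D'.
  by apply: cvgB => //; exact: cvgMl_tmp.
have u : (fun n => p n * (g n - 3 * D n) - (`|e n| + D n) * (`|e n| + D n)) @ \oo -->
    p' * (g' - 3 * D') - (0 + D') * (0 + D').
  by apply: cvgB; exact: cvgM.
have u0 : 0 < p' * (g' - 3 * D') - (0 + D') * (0 + D').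
  by rewrite add0r -expr2 subr_gt0.
near=> n; split; first by near: n; exact: (cvgr_gt _ pp).
by rewrite -subr_gt0 expr2; near: n; exact: (cvgr_gt _ u).
Unshelve. all: by end_near. Qed.

(** Both sides are homogeneous of degree 2, so averages may be replaced by sums. *)
Lemma determinant_scale (R : realFieldType) (s p e g D : R) : 0 < s ->
  (`|e * s| + D * s) ^+ 2 < p * s * (g * s - 3 * (D * s)) ->
  (`|e| + D) ^+ 2 < p * (g - 3 * D).
Proof.
move=> s0; rewrite normrM (gtr0_norm s0) => H.
by rewrite -(ltr_pM2r (exprn_gt0 2 s0)); lra.
Qed.

(** The limits of the pair averages satisfy p >= t, g >= (1 - r) t / 4 and D <= 4 (d + 1) / (m + 1),
    with [t] bounded below independently of [m]; the linear term tends to 0. So a fine grid gives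
    the strict inequality in the limit, hence for large [n]. *)
Lemma eventually_lambda2_gt (R : realType) d m L (r : R)
    (x : nat -> d.+1.-tuple R) :
  0 < r -> r < 1 -> 2 * L.+1%:R <= r * m.+1%:R ->
  r * m.+1%:R < 2 * L.+2%:R -> r / 4 <= L.+1%:R / m.+1%:R ->
  64 * d.+1%:R / ((r / 4) ^+ d.+1 ^+ 2 * (1 - r)) < m.+1%:R ->
  (forall i k, -1 <= tnth (x i) k < 1) ->
  (forall c : {ffun 'I_d.+1 -> 'I_m.+1},
    (fun n => (\sum_(i < n) (cell_index m (x i) == c)%:R) / n%:R : R) @ \oo -->
    ((m.+1%:R ^-1) ^+ d.+1 : R)) ->
  \forall n \near \oo,
    2^-1 < lambda 2 (normalized_adjmx r (fun i : 'I_n => x i)).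
Proof.
move=> r0 r1 lr rl rL mK x1 freq.
have M0 : 0 < m.+1%:R :> R by [].
have m1 : (1 < m.+1)%N.
  rewrite -(ltr_nat R) -(ltr_pM2l r0) mulr1; apply: (lt_le_trans r1).
  by apply: le_trans lr; rewrite -natrM ler1n.
have Lm : (L < m.+1)%N.
  have lr' : L.+1%:R <= r * m.+1%:R :> R by apply: le_trans lr; rewrite ler_peMl// ler1n.
  by rewrite ltnW// -(ltr_nat R) (le_lt_trans lr')// gtr_pMl.
pose c i := cell_index m (x i).
pose q : R := (m.+1%:R ^-1) ^+ d.+1.
pose V : R := m.+1%:R ^+ d.+1.
have V0 : 0 < V by rewrite exprn_gt0.
have qE : q = V^-1 by rewrite /q exprVn.
pose t : R := (L.+1%:R / m.+1%:R) ^+ d.+1.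
have tE : t = L.+1%:R ^+ d.+1 / V by rewrite /t expr_div_n.
have k0 : 0 < (r / 4) ^+ d.+1 by rewrite exprn_gt0// divr_gt0.
have kt : (r / 4) ^+ d.+1 <= t by rewrite lerXn2r ?nnegrE ?divr_ge0// ltW.
have lim := @cvg_mean_pairs R _ c q _ freq.
have pl := lim (fun g h => grid_near R L g h).
have el := lim (fun g h => grid_near R L g h * grid_mid R g).
have gl := lim (fun g h => grid_near R L g h *
  (2 * grid_mid R g * grid_mid R h - grid_mid R g ^+ 2)).
have Dl := lim (fun g h => grid_near R L.+2 g h - grid_near R L g h).
rewrite sum_grid_near_mid mulr0 in el.
have p_ge : t <= q ^+ 2 * \sum_g \sum_h @grid_near R d m.+1 L g h.
  rewrite qE tE exprVn [leRHS]mulrC ler_pdivlMr ?exprn_gt0//.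
  apply: le_trans (sum_grid_near_ge _ _ Lm).
  by rewrite -/V; rewrite le_eqVlt; apply/orP; left; apply/eqP; field; rewrite gt_eqF.
have p_le : q ^+ 2 * \sum_g \sum_h @grid_near R d m.+1 L g h <= 1.
  by rewrite qE exprVn [leLHS]mulrC ler_pdivrMr ?exprn_gt0// mul1r sum_grid_near_le.
have g_ge : (1 - r) * t / 4 <= q ^+ 2 * \sum_g \sum_h @grid_near R d m.+1 L g h *
    (2 * grid_mid R g * grid_mid R h - grid_mid R g ^+ 2).
  rewrite qE tE exprVn [leRHS]mulrC ler_pdivlMr ?exprn_gt0//.
  apply: le_trans (grid_drift d r1 lr m1).
  by rewrite -/V; rewrite le_eqVlt; apply/orP; left; apply/eqP; field; rewrite gt_eqF.
have D_le : q ^+ 2 * \sum_g \sum_h (@grid_near R d m.+1 L.+2 g h - grid_near R L g h)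
    <= 4 * d.+1%:R / m.+1%:R.
  rewrite qE exprVn [leLHS]mulrC ler_pdivrMr ?exprn_gt0//.
  apply: (le_trans (sum_grid_near_diff R d m.+1 L)).
  rewrite -/V -!mulrA !ler_pM2l//.
  suff -> : m.+1%:R ^+ d * V = m.+1%:R^-1 * V ^+ 2 by [].
  by rewrite expr2 mulrA {2}/V exprS mulKf ?gt_eqF.
have D_ge : 0 <= q ^+ 2 * \sum_g \sum_h (@grid_near R d m.+1 L.+2 g h - grid_near R L g h).
  rewrite mulr_ge0 ?sqr_ge0//.
  apply: sumr_ge0 => g _; apply: sumr_ge0 => h _; rewrite subr_ge0.
  by apply: grid_near_mono; rewrite ltnW.
have t0 : 0 < t by exact: lt_le_trans kt.
(* Here 64 is 16, needed in [DE], times the 4 of [D_le]. *)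
have Dt : 64 * d.+1%:R / m.+1%:R < t ^+ 2 * (1 - r).
  rewrite ltr_pdivrMr//; move: mK; rewrite ltr_pdivrMr; last first.
    by apply: mulr_gt0; [exact: exprn_gt0|rewrite subr_gt0].
  move=> /lt_le_trans; apply.
  rewrite mulrC ler_wpM2r// ler_wpM2r ?subr_ge0 ?(ltW r1)//.
  by rewrite lerXn2r ?nnegrE// ltW.
have := cvg_eventually_gt0 pl el gl Dl.
set p := q ^+ 2 * _ in p_ge p_le *.
set g := q ^+ 2 * _ in g_ge *.
set D := q ^+ 2 * _ in D_le D_ge *.
have DE : 16 * D < t ^+ 2 * (1 - r).
  apply: le_lt_trans Dt; apply: le_trans (_ : _ <= 16 * (4 * d.+1%:R / m.+1%:R)) _.
    by rewrite ler_pM2l.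
  by rewrite le_eqVlt; apply/orP; left; apply/eqP; field; rewrite gt_eqF.
have t1 : t <= 1 by exact: le_trans p_le.
have tt1 : t ^+ 2 * (1 - r) <= 1 by nra.
have pg : t ^+ 2 * (1 - r) / 4 <= p * g.
  have -> : t ^+ 2 * (1 - r) / 4 = t * ((1 - r) * t / 4) by field.
  apply: ler_pM => //; first exact: ltW.
  by rewrite !mulr_ge0 ?invr_ge0// ?subr_ge0 ltW.
have p0 : 0 < p by exact: lt_le_trans p_ge.
(* As [p] and [D] are at most 1, D^2 + 3 p D <= 4 D < t^2 (1 - r) / 4 <= p g. *)
have main : D ^+ 2 < p * (g - 3 * D) by nra.
move=> /(_ p0 main) H; near=> n.
have n0 : 0 < n%:R :> R by rewrite ltr0n; near: n; exists 1%N.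
have [] : 0 < (\sum_(i < n) \sum_(j < n) grid_near R L (c i) (c j)) / n%:R ^+ 2 /\
  (`|(\sum_(i < n) \sum_(j < n) grid_near R L (c i) (c j) * grid_mid R (c i)) / n%:R ^+ 2|
   + (\sum_(i < n) \sum_(j < n) (grid_near R L.+2 (c i) (c j) - grid_near R L (c i) (c j)))
     / n%:R ^+ 2) ^+ 2 <
  (\sum_(i < n) \sum_(j < n) grid_near R L (c i) (c j)) / n%:R ^+ 2 *
   ((\sum_(i < n) \sum_(j < n) grid_near R L (c i) (c j) *
      (2 * grid_mid R (c i) * grid_mid R (c j) - grid_mid R (c i) ^+ 2)) / n%:R ^+ 2
    - 3 * ((\sum_(i < n) \sum_(j < n) (grid_near R L.+2 (c i) (c j) - grid_near R L (c i) (c j)))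
     / n%:R ^+ 2)) by near: n; exact: H.
have N0 : 0 < n%:R ^- 2 :> R by rewrite invr_gt0 exprn_gt0.
rewrite pmulr_lgt0// => Pn.
move=> /(determinant_scale N0) Hn.
pose A := adjmx r (fun i : 'I_n => x i).
have loA (i j : 'I_n) :
    grid_near R L (c i) (c j) <= A i j <= grid_near R L.+2 (c i) (c j).
  by rewrite mxE; exact: grid_near_supdist.
have f1 (i : 'I_n) : `|grid_mid R (c i)| <= 1 by exact: midpoint_norm_le1.
have [A0 Af] := sandwich_determinant_gt0 loA f1 Pn Hn.
by apply: lambda2_normalized_adjmx_gt A0 Af; exact: ltW.
Unshelve. all: by end_near. Qed.

(* [X i] is the (i+1)-st random point. *)
Theorem theorem2p4 (R : realType) (disp : measure_display)
    (T : measurableType disp) (P : probability T R)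
    (d : nat) (hd : (1 <= d)%N) (r : R) (hr0 : 0 < r) (hr1 : r < 1)
    (X : nat -> {RV P >-> d.-tuple R}) (hX : iid_uniform_on_cube X) :
  {ae P, forall w : T, exists2 N : nat, (0 < N)%N &
    forall n : nat, (N <= n)%N ->
      2^-1 < lambda 2 (normalized_adjmx r (fun i : 'I_n => X i w))}.
Proof.
case: d hd X hX => // d _ X hX.
(* One grid, chosen from [r] and [d] alone, serves for all sample points [w]. *)
have [m [L [mK lr rl rL]]] :=
  exists_fine_grid (64 * d.+1%:R / ((r / 4) ^+ d.+1 ^+ 2 * (1 - r))) hr0.
have := ae_cell_frequency hX m; have := ae_sample_in_cube hX.
apply: filterS2 => w Xw freq.
have [N _ NP] := eventually_lambda2_gt hr0 hr1 lr rl rL mK Xw freq.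
by exists N.+1 => // n /ltnW; exact: NP.
Qed.
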